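(* For every integer $t\ge 0$ there is a constant $c_t$ such that every graph $G$ with $\mathrm{tww}(G)\le t$ satisfies $\alpha_2^*(G)\le c_t\,\alpha_2(G)$, where $\alpha_2(G)$ is the maximum size of a set of vertices of $G$ pairwise at distance at least $3$ in $G$, and $\alpha_2^*(G)$ is the optimum value of the linear program: maximize $\sum_{x\in V(G)}w(x)$ subject to $\sum_{y\in N[x]}w(y)\le 1$ for all $x\in V(G)$ and $0\le w(x)\le 1$ for all $x\in V(G)$.
   Context: $N[x]$ is the closed neighborhood of $x$ (its neighbors and $x$ itself). A trigraph $H$ consists of a vertex set $V(H)$ and two disjoint sets of unordered pairs of distinct vertices: black edges $E(H)$ and red edges $R(H)$. Two vertices are adjacent (neighbors) if they are joined by a black or a red edge. The red graph of $H$ is the graph $(V(H),R(H))$; $H$ is a $d$-trigraph if its red graph has maximum degree at most $d$. A graph is a trigraph with no red edges. Contracting two distinct vertices $u,v$ of a trigraph $H$ yields the trigraph obtained by deleting $u$ and $v$ and adding a new vertex $z$ such that, for every other vertex $x$: $zx$ is a black edge if both $ux$ and $vx$ are black edges; $zx$ is not an edge if $x$ is adjacent to neither $u$ nor $v$; and $zx$ is a red edge otherwise. All edges not incident to $u$ or $v$ are unchanged. A $d$-sequence of an $n$-vertex graph $G$ is a sequence of $d$-trigraphs $G=G_n,G_{n-1},\dots,G_1$ such that $G_1$ has a single vertex and each $G_{i-1}$ is obtained from $G_i$ by one contraction (so $G_i$ has $i$ vertices). The twin-width $\mathrm{tww}(G)$ of $G$ is the minimum $d$ such that $G$ admits a $d$-sequence.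 *)

(* Defs.v *)
From HB Require Import structures.
From mathcomp Require Import all_boot all_order all_algebra.
From mathcomp Require Import boolp classical_sets reals.
Set Implicit Arguments. Unset Strict Implicit. Unset Printing Implicit Defensive.
Import Order.TTheory GRing.Theory Num.Theory.

(* A (finite simple) graph is a symmetric irreflexive relation e on a finType T. *)

(* A trigraph whose vertices are named by elements of T: vertex set tV,
   black edges tB, red edges tR (only pairs inside tV are relevant). *)
Record trigraph (T : finType) := Trigraph {
  tV : {set T};
  tB : rel T;
  tR : rel T }.

Section Trigraphs.
Variable T : finType.

Definition tadj (H : trigraph T) : rel T := fun x y => tB H x y || tR H x y.

Definition graph_trigraph (e : rel T) : trigraph T :=
  Trigraph [set: T] e (fun _ _ => false).

Definition is_dtrigraph (d : nat) (H : trigraph T) : Prop :=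
  forall x, x \in tV H -> #|[set y in tV H | tR H x y]| <= d.

(* Contracting u and v: delete u and v and add a new vertex z; we name the
   new vertex z by u (vertex names are immaterial).  For every other vertex x:
   zx black iff ux and vx are both black; no edge iff x is adjacent to neither
   u nor v; red otherwise.  Other edges unchanged. *)
Definition cB (H : trigraph T) (u v : T) (x : T) : bool := tB H u x && tB H v x.
Definition cR (H : trigraph T) (u v : T) (x : T) : bool :=
  ~~ cB H u v x && (tadj H u x || tadj H v x).

Definition contract (H : trigraph T) (u v : T) : trigraph T :=
  Trigraph (tV H :\ v)
    (fun x y => if x == u then (y != u) && cB H u v y
                else if y == u then cB H u v x else tB H x y)
    (fun x y => if x == u then (y != u) && cR H u v y
                else if y == u then cR H u v x else tR H x y).

Fixpoint dseq (d : nat) (H : trigraph T) (s : seq (T * T)) : Prop :=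
  is_dtrigraph d H /\
  match s with
  | [::] => #|tV H| = 1
  | (u, v) :: s' => [/\ u \in tV H, v \in tV H, u != v & dseq d (contract H u v) s']
  end.

Definition has_dsequence (e : rel T) (d : nat) : Prop :=
  exists s, dseq d (graph_trigraph e) s.

Definition tww_le (e : rel T) (t : nat) : Prop :=
  exists2 d, d <= t & has_dsequence e d.

Definition dist_le (e : rel T) (k : nat) (x y : T) : Prop :=
  exists p : seq T, [/\ size p <= k, path e x p & last x p = y].

Definition dist3_set (e : rel T) (S : {set T}) : Prop :=
  forall x y, x \in S -> y \in S -> x != y -> ~ dist_le e 2 x y.

Definition alpha2 (e : rel T) : nat :=
  \max_(S : {set T} | `[< dist3_set e S >]) #|S|.

Definition closed_nbhd (e : rel T) (x : T) : {set T} := [set y | (y == x) || e x y].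

Definition lp_feasible (R : realType) (e : rel T) (w : T -> R) : Prop :=
  (forall x, (\sum_(y in closed_nbhd e x) w y <= 1)%R) /\
  (forall x, (0 <= w x <= 1)%R).

(* Optimum value of the LP: supremum of the objective over feasible points
   (the feasible region is nonempty, compact, so this is the maximum). *)
Definition alpha2_star (R : realType) (e : rel T) : R :=
  sup [set r : R | exists w : T -> R, lp_feasible e w /\ r = (\sum_x w x)%R].

End Trigraphs.

(* Main.v *)
Require Import Defs.
From HB Require Import structures.
From mathcomp Require Import all_boot all_order all_algebra.
From mathcomp Require Import boolp classical_sets reals.
From mathcomp Require Import fintype finset lra.
Import Order.TTheory GRing.Theory Num.Theory.

(** Let [w] be LP-feasible with total weight more than 1.  Follow the
    contraction sequence up to the first trigraph with a part [P] of weight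
    more than 1; all parts then have weight at most 2.  No black edge is
    incident to [P], since a vertex at its other end would see all of [P].
    So for [x] in [P] the second neighborhood of [x] is covered by [P], its at
    most [t] red neighbors [Q], and the neighbors of these: at most [t] red
    ones, and black ones of total weight at most 1, as all of them lie in the
    neighborhood of any vertex of [Q].  Hence this second neighborhood has
    weight at most [2 + t (2 + 2 t + 1)].  Taking such an [x] of positive
    weight, zeroing [w] on its second neighborhood and iterating yields the
    packing greedily. *)

(** * Weights of vertex sets *)

Section Mass.
Context {R : numDomainType} {T : finType}.
Variable w : T -> R.

Definition mass (A : {set T}) : R := (\sum_(x in A) w x)%R.

Lemma mass_setT : mass [set: T] = (\sum_x w x)%R.
Proof. by apply: eq_bigl => x; rewrite inE. Qed.

Hypothesis w_ge0 : forall x, (0 <= w x)%R.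

Lemma mass_subset (A B : {set T}) : A \subset B -> (mass A <= mass B)%R.
Proof.
move=> sAB; rewrite /mass [leRHS](bigID (mem A)) /=.
have -> : (\sum_(x in B | x \in A) w x = \sum_(x in A) w x)%R.
  by apply: eq_bigl => x; apply: andb_idl => /(subsetP sAB).
by rewrite lerDl sumr_ge0.
Qed.

Lemma mass_setU (A B : {set T}) : (mass (A :|: B) <= mass A + mass B)%R.
Proof.
rewrite {1}/mass (big_setID A) /=; apply: lerD; apply: mass_subset.
  exact: subsetIr.
by rewrite setDUl setDv set0U subsetDl.
Qed.

Lemma mass_bigcup (I : finType) (D : {set I}) (F : I -> {set T}) n (c : R) :
  #|D| <= n -> (0 <= c)%R -> (forall i, i \in D -> (mass (F i) <= c)%R) ->
  (mass (\bigcup_(i in D) F i) <= c * n%:R)%R.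
Proof.
move=> leDn c_ge0 leFc.
have : (mass (\bigcup_(i in D) F i) <= \sum_(i in D) c)%R.
  elim/big_rec2: _ => [|i A y Di leAy]; first by rewrite /mass big_set0.
  by apply: le_trans (mass_setU _ _) _; apply: lerD => //; apply: leFc.
move/le_trans; apply; rewrite sumr_const -[(c *+ _)%R]mulr_natr.
by rewrite ler_wpM2l // ler_nat.
Qed.

End Mass.

(** * Second neighborhoods *)

Definition near2 {T : finType} (e : rel T) (x : T) : {set T} :=
  [set y | [|| y == x, e x y | [exists z, e x z && e z y]]].

Lemma dist_le2_near2 (T : finType) (e : rel T) x y :
  dist_le e 2 x y -> y \in near2 e x.
Proof.
rewrite inE => -[[|z [|z' [|z'' p]]] //= []] // _ pth <-; first by rewrite eqxx.
  by case/andP: pth => ->; rewrite orbT.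
have -> : [exists z0, e x z0 && e z0 z'].
  by apply/existsP; exists z; move: pth; rewrite andbT.
by rewrite !orbT.
Qed.

Lemma near2_sym (T : finType) (e : rel T) x y :
  symmetric e -> (y \in near2 e x) = (x \in near2 e y).
Proof.
move=> e_sym; rewrite !inE eq_sym e_sym; congr [|| _, _ | _].
by apply: eq_existsb => z; rewrite andbC (e_sym x) (e_sym y).
Qed.

(** * Trigraphs of the sequence as quotients of the graph *)

(* [f] sends a vertex of the graph to the name of its part in the trigraph. *)
Record represents {T : finType} (e : rel T) (H : trigraph T) (f : T -> T) :
    Prop := Represents {
  rep_mem : forall x, f x \in tV H;
  rep_fix : forall a, a \in tV H -> f a = a;
  rep_symB : symmetric (tB H);
  rep_symR : symmetric (tR H);
  rep_edge : forall x y, f x != f y -> e x y -> tadj H (f x) (f y);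
  rep_black : forall x y, f x != f y -> tB H (f x) (f y) -> e x y }.

Lemma represents_graph (T : finType) (e : rel T) :
  symmetric e -> represents e (graph_trigraph e) id.
Proof. by move=> e_sym; split=> //= x y _; rewrite /tadj /= ?inE // => ->. Qed.

Definition merge {T : finType} (u v : T) (f : T -> T) (x : T) : T :=
  if f x == v then u else f x.

(** A black edge at the merged vertex requires black edges at both [u] and [v], so it still stands
    for a complete pair of parts. An edge of the graph leaving either part makes [u] or [v] adjacent
    to its other end, and [cR] catches whatever [cB] misses. *)
Lemma represents_contract (T : finType) (e : rel T) (H : trigraph T) f u v :
  symmetric e -> represents e H f -> u \in tV H -> v \in tV H -> u != v ->
  represents e (contract H u v) (merge u v f).
Proof.
move=> e_sym [mem fix_ symB symR edge black] uV vV neq_uv.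
have cR_adj a : tadj H u a || tadj H v a -> cB H u v a || cR H u v a.
  by rewrite /cR => ->; rewrite andbT orbN.
have edge_u x y : merge u v f x = u -> f y != u -> f y != v -> e x y ->
    cB H u v (f y) || cR H u v (f y).
  rewrite /merge; case: eqP => [fxv _|_ fxu] nyu nyv exy; apply: cR_adj.
    by rewrite -fxv (edge x y) ?orbT // fxv eq_sym.
  by rewrite -fxu (edge x y) // fxu eq_sym.
have black_u x y : merge u v f x = u -> f y != u -> f y != v ->
    cB H u v (f y) -> e x y.
  rewrite /merge => fxu nyu nyv /andP[Bu Bv]; apply: black.
    by case: eqP fxu => [-> _|_ ->]; rewrite eq_sym.
  by case: eqP fxu => [-> _|_ ->].
(* Away from [u] merging changes nothing, so only pairs with an end in the merged part need new
   work. *)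
have merge_neq y : merge u v f y != u ->
    [/\ merge u v f y = f y, f y != u & f y != v].
  by rewrite /merge; case: (eqVneq (f y) v) => [_|//]; rewrite eqxx.
split=> /=.
- move=> x; rewrite /merge !inE; case: ifPn => [_|->]; last exact: mem.
  by rewrite neq_uv.
- by move=> a /setD1P[nav aV]; rewrite /merge fix_ // (negPf nav).
- move=> x y; case: (eqVneq x u) => [->|nx]; case: (eqVneq y u) => //=.
- move=> x y; case: (eqVneq x u) => [->|nx]; case: (eqVneq y u) => //=.
- move=> x y; rewrite /tadj /=.
  case: (eqVneq (merge u v f x) u) => [mx|/merge_neq[-> nxu nxv]];
    case: (eqVneq (merge u v f y) u) => [my|/merge_neq[-> nyu nyv]] => //=.
  + by rewrite mx my eqxx.
  + by move=> _ exy; apply: (edge_u x).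
  + by move=> _ exy; apply: (edge_u y); rewrite // e_sym.
  + by move=> n exy; apply: edge.
- move=> x y.
  case: (eqVneq (merge u v f x) u) => [mx|/merge_neq[-> nxu nxv]];
    case: (eqVneq (merge u v f y) u) => [my|/merge_neq[-> nyu nyv]] => //=.
  + by move=> _ Bxy; apply: (black_u x).
  + by move=> _ Bxy; rewrite e_sym; apply: (black_u y).
  + by move=> n Bxy; apply: black.
Qed.

Lemma dseq_leq (T : finType) d t (H : trigraph T) s :
  d <= t -> dseq d H s -> dseq t H s.
Proof.
move=> le_dt; elim: s H => [|[u v] s IHs] H /= [dH Hs]; split.
- by move=> x xV; apply: leq_trans (dH x xV) le_dt.
- exact: Hs.
- by move=> x xV; apply: leq_trans (dH x xV) le_dt.
- by case: Hs => uV vV neq /IHs.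
Qed.

(** * Finding a vertex with a light second neighborhood *)

Section Packing.
Context {R : realType} {T : finType}.
Variables (e : rel T) (t : nat).
Hypothesis e_sym : symmetric e.

Definition near2_bound : R := (2 + (3 + 2 * t%:R) * t%:R)%R.

Lemma near2_bound_ge2 : (2 <= near2_bound)%R.
Proof.
have t_ge0 := ler0n R t.
by rewrite lerDl mulr_ge0 // addr_ge0 // mulr_ge0.
Qed.

Definition part (f : T -> T) (a : T) : {set T} := [set x | f x == a].

Definition red_nbrs (H : trigraph T) (a : T) : {set T} :=
  [set b in tV H | tR H a b].

(** [represents] says nothing about loops of [tB]; the guard [f x != a] keeps the zone away from the
    part of [a] itself. *)
Definition black_zone (H : trigraph T) (f : T -> T) (a : T) : {set T} :=
  [set x | (f x != a) && tB H a (f x)].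

Section Feasible.
Variable w : T -> R.
Hypothesis w_feasible : lp_feasible e w.

Let w_ge0 x : (0 <= w x)%R.
Proof. by case: w_feasible => _ /(_ x)/andP[]. Qed.

(** By [rep_fix] the name [a] is itself a vertex of its part, hence adjacent in the graph to the
    whole zone; the bound is the linear constraint at [a]. *)
Lemma mass_black_zone H f a :
  represents e H f -> a \in tV H -> (mass w (black_zone H f a) <= 1)%R.
Proof.
move=> rep aV; case: w_feasible => /(_ a) + _; apply: le_trans.
apply: mass_subset => //; apply/subsetP=> y; rewrite !inE.
rewrite -{1 2}(rep_fix _ _ _ rep _ aV) eq_sym => /andP[ney Bay].
by rewrite (rep_black _ _ _ rep _ _ ney Bay) orbT.
Qed.

Lemma heavy_part_no_black H f a x : represents e H f ->
  (1 < mass w (part f a))%R -> f x != a -> ~~ tB H a (f x).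
Proof.
move=> rep heavy nxa; apply/negP=> Bax; move: heavy; rewrite ltNge => /negP; apply.
case: w_feasible => /(_ x) + _; apply: le_trans; apply: mass_subset => //.
apply/subsetP=> y; rewrite !inE => /eqP fya.
by rewrite (rep_black _ _ _ rep x y) ?orbT // fya // (rep_symB _ _ _ rep).
Qed.

Lemma near2_cover H f x : represents e H f ->
  (1 < mass w (part f (f x)))%R ->
  near2 e x \subset part f (f x) :|: \bigcup_(q in red_nbrs H (f x))
    (part f q :|: \bigcup_(r in red_nbrs H q) part f r :|: black_zone H f q).
Proof.
move=> rep heavy.
(* Stated for every [z] in the part of [x], so that it also serves a middle vertex that has not left
   that part. *)
have step z y : f z = f x -> e z y -> f y = f x \/ f y \in red_nbrs H (f x).
  move=> fz ezy; case: (eqVneq (f y) (f x)) => [|ne]; [by left | right].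
  rewrite inE (rep_mem _ _ _ rep) /=.
  have nezy : f z != f y by rewrite fz eq_sym.
  have := rep_edge _ _ _ rep _ _ nezy ezy.
  by rewrite fz /tadj (negPf (heavy_part_no_black _ _ _ _ rep heavy ne)).
have cover1 y : f y = f x \/ f y \in red_nbrs H (f x) ->
    y \in part f (f x) :|: \bigcup_(q in red_nbrs H (f x))
    (part f q :|: \bigcup_(r in red_nbrs H q) part f r :|: black_zone H f q).
  case=> [fy|qy]; rewrite inE; apply/orP; [left | right].
    by rewrite inE fy.
  by apply/bigcupP; exists (f y); rewrite // !inE eqxx.
apply/subsetP=> y; rewrite [_ \in near2 _ _]inE.
case/or3P=> [/eqP->|exy|/existsP[z /andP[exz ezy]]].
- by apply: cover1; left.
- by apply: cover1; apply: step exy.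
(* A middle vertex outside the heavy part lies in the part of a red neighbor; the edge from [z] to
   [y] then stays in that part or crosses along a black or a red edge. *)
case: (step _ _ erefl exz) => [fz|qz]; first by apply: cover1; apply: step ezy.
rewrite inE; apply/orP; right; apply/bigcupP; exists (f z) => //.
case: (eqVneq (f y) (f z)) => [fyz|ne]; first by rewrite !inE fyz eqxx.
have nezy : f z != f y by rewrite eq_sym.
rewrite inE; apply/orP.
case/orP: (rep_edge _ _ _ rep _ _ nezy ezy) => [Bzy|Rzy]; [right|left].
  by rewrite inE ne.
rewrite inE; apply/orP; right; apply/bigcupP; exists (f y); rewrite !inE //.
by rewrite (rep_mem _ _ _ rep).
Qed.

Lemma mass_near2_heavy H f x : represents e H f -> is_dtrigraph t H ->
  (forall a, mass w (part f a) <= 2)%R -> (1 < mass w (part f (f x)))%R ->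
  (mass w (near2 e x) <= near2_bound)%R.
Proof.
move=> rep dH le2 heavy.
apply: le_trans (mass_subset _ w_ge0 _ _ (near2_cover _ _ _ rep heavy)) _.
apply: le_trans (mass_setU _ w_ge0 _ _) _; apply: lerD; first exact: le2.
have t_ge0 := ler0n R t.
apply: mass_bigcup => //; first exact: dH (rep_mem _ _ _ rep _).
  by rewrite addr_ge0 // mulr_ge0.
move=> q; rewrite inE => /andP[qV _].
apply: le_trans (mass_setU _ w_ge0 _ _) _.
have le_black := mass_black_zone _ _ _ rep qV.
have le_red : (mass w (\bigcup_(r in red_nbrs H q) part f r) <= 2 * t%:R)%R.
  by apply: mass_bigcup => //; apply: dH.
have := mass_setU _ w_ge0 (part f q) (\bigcup_(r in red_nbrs H q) part f r).
have := le2 q.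
lra.
Qed.

Lemma part_merge u v f a : u != v ->
  part (merge u v f) a \subset (if a == u then part f u :|: part f v else part f a).
Proof.
move=> neq; apply/subsetP=> x; rewrite inE /merge.
case: (eqVneq (f x) v) => [fxv /eqP<-|nfx /eqP<-].
  by rewrite eqxx !inE fxv eqxx orbT.
by case: ifP => [/eqP fxu|_]; rewrite !inE ?fxu eqxx.
Qed.

Lemma exists_heavy_light H f s : represents e H f -> dseq t H s ->
  (forall a, mass w (part f a) <= 1)%R -> (1 < mass w [set: T])%R ->
  exists2 x, (0 < w x)%R & (mass w (near2 e x) <= near2_bound)%R.
Proof.
elim: s H f => [|[u v] s IHs] H f rep /= [dH].
  (* The last trigraph has a single part, which contains every vertex and so is heavy: the invariant
     that all parts weigh at most 1 must break earlier. *)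
  move/eqP/cards1P=> [a defV] le1 big; have := le1 a; rewrite leNgt.
  have -> : part f a = [set: T]; last by rewrite big.
  by apply/setP=> x; have := rep_mem _ _ _ rep x; rewrite defV !inE.
case=> uV vV neq Hs le1 big.
have rep' := represents_contract _ _ _ _ _ _ e_sym rep uV vV neq.
have [le1'|] := boolP [forall a, (mass w (part (merge u v f) a) <= 1)%R].
  by apply: IHs rep' Hs _ big => a; apply: (forallP le1').
rewrite negb_forall => /existsP[a]; rewrite -ltNge => heavy.
have dH' : is_dtrigraph t (contract H u v) by case: s Hs {IHs} => [|[? ?] ?] [].
(* Only the part named [u] can have grown, and it unites two parts of weight at most 1. *)
have le2 b : (mass w (part (merge u v f) b) <= 2)%R.
  apply: le_trans (mass_subset _ w_ge0 _ _ (part_merge u v f b neq)) _.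
  case: ifP => _; last by apply: le_trans (le1 b) _; lra.
  apply: le_trans (mass_setU _ w_ge0 _ _) _.
  by have := le1 u; have := le1 v; lra.
have [x xa wx] : exists2 x, x \in part (merge u v f) a & (0 < w x)%R.
  apply/exists_inP; apply: contraTT heavy; rewrite negb_exists_in -leNgt.
  move/forall_inP=> le0; apply: le_trans (ler01 : (0 <= 1 :> R)%R).
  by apply: sumr_le0 => x /le0; rewrite -leNgt.
exists x => //; apply: (mass_near2_heavy _ _ _ rep' dH' le2).
by move: xa; rewrite inE => /eqP->.
Qed.

End Feasible.

(** * Greedy packing and the linear program *)

Hypothesis e_tww : tww_le e t.

Lemma exists_light (w : T -> R) : lp_feasible e w ->
  (exists x, 0 < w x)%R ->
  exists2 x, (0 < w x)%R & (mass w (near2 e x) <= near2_bound)%R.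
Proof.
move=> fw [x wx]; have w_ge0 y : (0 <= w y)%R by case: fw => _ /(_ y)/andP[].
(* With total weight at most 1 there need be no heavy part, but then every second neighborhood
   weighs at most 1, below the bound. *)
have [le1|gt1] := leP (mass w [set: T]) 1%R.
  exists x => //; apply: le_trans near2_bound_ge2.
  apply: le_trans (mass_subset _ w_ge0 _ _ (subsetT _)) _.
  by apply: le_trans le1 _; lra.
case: e_tww => d le_dt [s /(dseq_leq _ _ _ _ _ le_dt) Hs].
apply: (exists_heavy_light _ fw _ _ _ (represents_graph _ _ e_sym) Hs _ gt1).
(* Before any contraction the parts are singletons, light because [w] is at most 1. *)
move=> a; have -> : part id a = [set a] by apply/setP=> y; rewrite !inE.
by rewrite /mass big_set1; case: fw => _ /(_ a)/andP[].
Qed.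

(** Positive weight on the packing is what closes the induction on the size of the support: vertices
    chosen after [w] is zeroed on a second neighborhood cannot lie in it. *)
Lemma exists_packing (w : T -> R) : lp_feasible e w ->
  exists S : {set T}, [/\ dist3_set e S, forall x, x \in S -> (0 < w x)%R
    & (mass w [set: T] <= near2_bound * #|S|%:R)%R].
Proof.
have [n] := ubnP #|[set x | (0 < w x)%R]|.
elim: n => // n IHn in w * => supp fw.
have w_ge0 y : (0 <= w y)%R by case: fw => _ /(_ y)/andP[].
have [[x wx]|w0] := pselect (exists x, 0 < w x)%R; last first.
  exists set0; split=> [x y|x|]; rewrite ?inE // cards0 mulr0.
  by apply: sumr_le0 => x _; rewrite leNgt; apply/negP=> wx; apply: w0; exists x.
have {x wx} [x wx light] := exists_light w fw (ex_intro _ x wx).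
pose w' y := if y \in near2 e x then 0%R else w y.
have w'_le y : (0 <= w' y <= w y)%R.
  by rewrite /w'; case: ifP => _; rewrite lexx w_ge0.
have fw' : lp_feasible e w'.
  case: fw => sum1 le1; split=> y.
    by apply: le_trans (sum1 y); apply: ler_sum => z _; case/andP: (w'_le z).
  case/andP: (w'_le y) => -> /le_trans; apply; by case/andP: (le1 y).
have xnear : x \in near2 e x by rewrite inE eqxx.
have supp' : #|[set y | (0 < w' y)%R]| < n.
  rewrite -ltnS; apply: leq_trans supp; rewrite ltnS; apply: proper_card.
  apply/properP; split; last first.
    by exists x; rewrite !inE // /w' xnear ltxx.
  apply/subsetP=> y; rewrite !inE => /lt_le_trans; apply.
  by case/andP: (w'_le y).
have [S [packS posS massS]] := IHn w' supp' fw'.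
have farS y : y \in S -> y \notin near2 e x.
  by move/posS; rewrite /w'; case: ifP; rewrite ?ltxx.
have xS : x \notin S by apply/negP=> /farS; rewrite xnear.
exists (x |: S); split.
- move=> y z; rewrite !inE => /orP[/eqP->|yS] /orP[/eqP->|zS] ne; last exact: packS.
  + by rewrite eqxx in ne.
  + by move/dist_le2_near2; apply/negP; apply: farS.
  + by move/dist_le2_near2; rewrite near2_sym //; apply/negP; apply: farS.
- move=> y; rewrite !inE => /orP[/eqP-> //|/posS/lt_le_trans]; apply.
  by case/andP: (w'_le y).
rewrite cardsU1 xS natrD mulrDr mulr1.
(* The total of [w] splits into the weight near [x], paid for by the new vertex [x], and the total
   of [w']. *)
apply: le_trans (lerD light massS).
rewrite !mass_setT /mass [X in (_ <= X + _)%R]big_mkcond -big_split /=.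
by apply: ler_sum => y _; rewrite /w'; case: ifP => _; rewrite ?addr0 ?add0r.
Qed.

Lemma alpha2_star_le : (alpha2_star R e <= near2_bound * (alpha2 e)%:R)%R.
Proof.
apply: ge_sup.
  (* Bounding the supremum requires a nonempty set of values; the zero weighting provides one. *)
  exists 0%R; exists (fun _ => 0%R); rewrite big1 //; split=> //; split=> x.
    by rewrite big1 // ler01.
  by rewrite lexx ler01.
move=> r [w [fw ->]]; have [S [packS _ massS]] := exists_packing w fw.
rewrite -mass_setT; apply: le_trans massS _; rewrite ler_wpM2l //.
  by apply: le_trans near2_bound_ge2; lra.
by rewrite ler_nat; apply: leq_bigmax_cond; apply/asboolP.
Qed.

End Packing.

Theorem mainTheorem15 (R : realType) :
  forall t : nat, exists c : R,
    forall (T : finType) (e : rel T),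
      symmetric e -> irreflexive e -> tww_le e t ->
      (alpha2_star R e <= c * (alpha2 e)%:R)%R.
Proof.
move=> t; exists (near2_bound t) => T e e_sym _ e_tww.
exact: alpha2_star_le.
Qed.
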